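(* Let $G$ be a generalised dihedral group of order $2n$ over the abelian group $A$, and let $\Gamma=\mathrm{Cay}(G,S)$. If $|S\cap xA|\le 2$, then $\gamma_{\mathrm{all}}^\infty(\Gamma)=\gamma(\Gamma)$.
   Context: Groups and graphs are finite. For an abelian group $A$, the generalised dihedral group over $A$ is $G=\langle A,x : x^2=1,\ x^{-1}ax=a^{-1}\ \forall a\in A\rangle$, i.e. the semidirect product $A\rtimes\langle x\rangle$ with $x\notin A$ of order 2 acting by inversion; $xA$ is the nontrivial coset of $A$. For a group $G$ and an inverse-closed subset $S\subseteq G$, $\mathrm{Cay}(G,S)$ is the graph with vertex set $G$ and an edge from $u$ to $us$ for every $u\in G$, $s\in S$. The identity may be allowed in $S$ (giving a loop at every vertex); such loops are irrelevant to domination. A vertex $u$ dominates a vertex $w$ if $w=u$ or $w$ is adjacent to $u$. A dominating set is a set $D$ of vertices such that every vertex is dominated by at least one vertex of $D$; $\gamma(\Gamma)$ is the smallest size of a dominating set of $\Gamma$. Guards located at the vertices of a set $D$ (one guard per vertex) can reconfigure to a set $D'$ if there is a bijection $f:D\to D'$ such that for every $d\in D$, either $f(d)=d$ or $f(d)$ is adjacent to $d$. An eternal dominating configuration for $\Gamma$ is a nonempty collection $\mathcal D$ of subsets of $V(\Gamma)$, all of the same cardinality, such that for every $D_i\in\mathcal D$ and every vertex $w\notin D_i$ there is $D_j\in\mathcal D$ with $w\in D_j$ such that guards at $D_i$ can reconfigure to $D_j$. An eternal dominating set is a member of some eternal dominating configuration. The eternal domination number $\gamma_{\mathrm{all}}^\infty(\Gamma)$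 is the smallest cardinality of an eternal dominating set. *)

(* Defs.v *)
From mathcomp Require Import all_boot all_fingroup.

Set Implicit Arguments.
Unset Strict Implicit.
Unset Printing Implicit Defensive.

Import GroupScope.

(* A graph on the finite vertex type T is given by its adjacency relation
   e : rel T, which may have loops. *)
Section Domination.

Variables (T : finType) (e : rel T).

Definition dominates (u w : T) : bool := (w == u) || e u w.

Definition dominating_set (D : {set T}) : bool :=
  [forall w, exists u in D, dominates u w].

(* Only the values of f on D matter: f restricts to a bijection D -> D'. *)
Definition reconfigures (D D' : {set T}) : bool :=
  [exists f : {ffun T -> T},
    [&& dinjectiveb f (mem D), f @: D == D'
      & [forall d in D, (f d == d) || e d (f d)]]].

Definition eternal_dominating_configuration (C : {set {set T}}) : bool :=
  [&& C != set0,
      [forall D1 in C, forall D2 in C, #|D1| == #|D2|]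
    & [forall Di in C, forall (w | w \notin Di),
         exists Dj in C, (w \in Dj) && reconfigures Di Dj]].

Definition eternal_dominating_set (D : {set T}) : bool :=
  [exists C : {set {set T}}, eternal_dominating_configuration C && (D \in C)].

Lemma dominating_setT : dominating_set [set: T].
Proof.
by apply/forallP => w; apply/exists_inP; exists w; rewrite ?inE ?/dominates ?eqxx.
Qed.

Lemma eternal_dominating_setT : eternal_dominating_set [set: T].
Proof.
apply/existsP; exists [set [set: T]]; rewrite set11 andbT; apply/and3P; split.
- by apply/set0Pn; exists [set: T]; rewrite set11.
- by apply/forall_inP => D1 /set1P->; apply/forall_inP => D2 /set1P->.
- by apply/forall_inP => D /set1P->; apply/forall_inP => w; rewrite inE.
Qed.

(* By the two lemmas above, [set: T] is a legitimate starting candidate, so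
   both minima range over a nonempty family. *)
Definition domination_number : nat :=
  #|[arg min_(D < [set: T] | dominating_set D) #|D|]|.

Definition eternal_domination_number : nat :=
  #|[arg min_(D < [set: T] | eternal_dominating_set D) #|D|]|.

End Domination.

Section Cayley.

Variable gT : finGroupType.

Definition inverse_closed (S : {set gT}) : Prop :=
  {in S, forall s, s^-1 \in S}.

(* The left translate u *: S is the set of all u * s with s \in S. *)
Definition Cay (S : {set gT}) : rel gT := fun u w => w \in u *: S.

Lemma Cay_sym (S : {set gT}) : inverse_closed S -> symmetric (Cay S).
Proof.
move=> hS u w; rewrite /Cay !mem_lcoset.
by apply/idP/idP => /hS; rewrite invMg invgK.
Qed.

(* The semidirect product condition contains x \notin A, as A and <[x]>
   intersect trivially. *)
Definition generalised_dihedral (G A : {group gT}) (x : gT) : Prop :=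
  [/\ abelian A, #[x] = 2, A ><| <[x]> = G
    & {in A, forall a, a ^ x = a^-1}].

End Cayley.

(* Main.v *)
(* It suffices that every edge (u, w) is realised by an injective graph
   endomorphism f with f u = w that moves each vertex to itself or to a
   neighbour: the dominating sets of minimum size then form an eternal
   dominating configuration, the guards at D answering an attack at w by
   moving to f @: D.
   For an edge labelled by s in A, left translation by w u^-1 is such a map,
   because every element of G centralises or inverts A.  For an edge labelled
   by s outside A, let t be the other element of S outside A (t = s if there
   is none); right multiplication by s on one coset of A and by t on the other
   is such a map, because s and t are involutions. *)
Require Import Defs.
From mathcomp Require Import all_boot all_fingroup.

Set Implicit Arguments.
Unset Strict Implicit.
Unset Printing Implicit Defensive.

Import GroupScope.

Section NeighbourMaps.

Variables (T : finType) (e : rel T).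

(** The guard that moves onto an attacked vertex [w] comes from some [d] in [D] with [f d = w], and
    this [d] dominates [w]. *)
Lemma eternal_dominating_set_dominating (D : {set T}) :
  eternal_dominating_set e D -> dominating_set e D.
Proof.
case/existsP=> C /andP[/and3P[_ _ /forall_inP hC] CD].
apply/forallP=> w; apply/exists_inP.
have [wD | wND] := boolP (w \in D); first by exists w; rewrite // /dominates eqxx.
have /exists_inP[D' _ /andP[wD' /existsP[f]]] := forall_inP (hC D CD) w wND.
case/and3P=> _ /eqP fD /forall_inP fe.
move: wD'; rewrite -fD => /imsetP[d dD ->].
by exists d => //; apply: fe.
Qed.

Lemma eternal_domination_number_eq :
  (forall u w, e u w -> exists f : T -> T,
     [/\ injective f, {homo f : v r / e v r},
         forall v, dominates e v (f v) & f u = w]) ->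
  eternal_domination_number e = domination_number e.
Proof.
move=> he; rewrite /eternal_domination_number /domination_number.
case: arg_minnP => [|D hD minD]; first exact: eternal_dominating_setT.
case: arg_minnP => [|D0 hD0 minD0]; first exact: dominating_setT.
apply/eqP; rewrite eqn_leq minD0 ?eternal_dominating_set_dominating // andbT.
apply: minD; apply/existsP.
exists [set D' | dominating_set e D' & #|D'| == #|D0|].
rewrite inE hD0 eqxx !andbT; apply/and3P; split.
- by apply/set0Pn; exists D0; rewrite inE hD0 eqxx.
- apply/forall_inP=> D1; rewrite inE => /andP[_ /eqP->].
  by apply/forall_inP=> D2; rewrite inE => /andP[_ /eqP->].
apply/forall_inP=> D1; rewrite inE => /andP[/forallP domD1 /eqP cardD1].
apply/forall_inP=> w wND1; have /exists_inP[u uD1] := domD1 w.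
case/orP=> [/eqP w_u | /he[f [injf homf domf fu]]].
  by rewrite w_u uD1 in wND1.
apply/exists_inP; exists (f @: D1); last first.
  rewrite -fu imset_f //=; apply/existsP; exists (finfun f).
  apply/and3P; split.
  - by apply/dinjectiveP => a b _ _; rewrite !ffunE => /injf.
  - by apply/eqP/eq_imset => a; rewrite ffunE.
  - by apply/forall_inP=> d _; rewrite ffunE; apply: domf.
rewrite inE card_imset // cardD1 eqxx andbT; apply/forallP=> v.
(* [T] is finite, so [f] is onto and [v = f (g v)]; a guard [d] dominating [g v] is carried by [f]
   to one dominating [v]. *)
have [g _ gK] := injF_bij injf.
have /exists_inP[d dD1 dv] := domD1 (g v).
apply/exists_inP; exists (f d); first exact: imset_f.
rewrite -(gK v); case/orP: dv => [/eqP-> | /homf edv].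
  by rewrite /dominates eqxx.
by rewrite /dominates edv orbT.
Qed.

End NeighbourMaps.

Section GeneralisedDihedral.

Variables (gT : finGroupType) (A : {group gT}) (x : gT).
Hypothesis hG : generalised_dihedral [set: gT]%G A x.

Lemma dihedral_cosetC : x *: A = ~: A.
Proof.
case: hG => _ ox /sdprodP[_ defG nAx tiAx] _.
have xA : x \notin A.
  apply/negP=> xA; have x1 : x = 1.
    by apply/set1gP; rewrite -tiAx inE xA cycle_id.
  by rewrite x1 order1 in ox.
apply/setP=> v; rewrite inE mem_lcoset; apply/idP/idP=> [xv | vA].
  by apply: contra xA => vA; rewrite -groupV -(groupMr _ vA).
have: v \in A * <[x]> by rewrite defG inE.
case/mulsgP=> a y Aa; rewrite cycle2g // => /set2P[->|->] def_v.
  by rewrite def_v mulg1 Aa in vA.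
(* Here [v = a * x], and [x^-1 * (a * x)] is the conjugate [a ^ x], which stays in [A] by
   normality. *)
by rewrite def_v -/(conjg a x) memJ_norm // (subsetP nAx) ?cycle_id.
Qed.

Lemma dihedral_conjV (a v : gT) : a \in A -> v \notin A -> a ^ v = a^-1.
Proof.
case: hG => abA _ _ invA aA; rewrite -in_setC -dihedral_cosetC.
case/lcosetP=> b bA ->; rewrite conjgM invA //.
by apply/conjg_fixP/commgP; apply: (centsP abA); rewrite ?groupV.
Qed.

Lemma dihedral_conj (a v : gT) : a \in A -> (a ^ v == a) || (a ^ v == a^-1).
Proof.
move=> aA; have [vA | vNA] := boolP (v \in A).
  case: hG => abA _ _ _.
  by apply/orP; left; apply/eqP/conjg_fixP/commgP/(centsP abA).
by rewrite (dihedral_conjV aA vNA) eqxx orbT.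
Qed.

(** Writing [v = x * b] with [b] in [A], the square is [b ^ x * b = b^-1 * b], because
    [x = x^-1]. *)
Lemma dihedral_invol (v : gT) : v \notin A -> v * v = 1.
Proof.
case: hG => _ ox _ invA; rewrite -in_setC -dihedral_cosetC.
case/lcosetP=> b bA ->.
have xx : x * x = 1 by rewrite -(expg_order x) ox.
have xV : x^-1 = x by apply/eqP; rewrite eq_invg_mul xx.
by rewrite -mulgA (mulgA b) -{1}xV mulgA -/(conjg b x) invA // mulVg.
Qed.

Lemma dihedral_mulNN (u v : gT) : u \notin A -> v \notin A -> u * v \in A.
Proof.
rewrite -!in_setC -dihedral_cosetC => /lcosetP[a aA ->] /lcosetP[b bA ->].
case: hG => _ ox _ invA.
have xx : x * x = 1 by rewrite -(expg_order x) ox.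
have xV : x^-1 = x by apply/eqP; rewrite eq_invg_mul xx.
by rewrite mulgA groupMr // -{1}xV -mulgA -/(conjg a x) invA // groupV.
Qed.

Lemma dihedral_mem_mul (u v : gT) : (u * v \in A) = ((u \in A) == (v \in A)).
Proof.
have [uA | uNA] := boolP (u \in A); first by rewrite groupMl.
have [vA | vNA] := boolP (v \in A); last by rewrite dihedral_mulNN.
by rewrite groupMr // (negPf uNA).
Qed.

Variable S : {set gT}.
Hypothesis hS : inverse_closed S.

Lemma dihedral_connection_conj (s v : gT) :
  s \in S -> s \in A -> s ^ v \in S.
Proof.
by move=> sS sA; case/orP: (dihedral_conj v sA) => /eqP->; rewrite ?hS.
Qed.

Definition coset_twist (s t v : gT) : gT := v * (if v \in A then s else t).

(** Multipliers outside [A] swap the two cosets, so the image reveals the coset of the argument,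
    hence which multiplier to cancel. *)
Lemma coset_twist_inj (s t : gT) :
  s \notin A -> t \notin A -> injective (coset_twist s t).
Proof.
move=> sNA tNA u v; rewrite /coset_twist => eq_uv.
have eqA : (u \in A) = (v \in A).
  have := congr1 (fun z => z \in A) eq_uv; rewrite /= !dihedral_mem_mul.
  by case: (u \in A); case: (v \in A); rewrite ?(negPf sNA) ?(negPf tNA).
by move: eq_uv; rewrite eqA => /mulIg.
Qed.

(** Put [k = v^-1 * r], and let [p], [q] be the multipliers applied to [v], [r]; the images differ
    by [p^-1 * k * q]. If [k] is in [A] then [p = q], giving a conjugate of [k]. Otherwise [p], [q]
    are [s], [t] in some order and [k] is one of them: [k = p] leaves [q], and [k = q] leaves [p^-1]
    since [q] is an involution. *)
Lemma coset_twist_homo (s t : gT) :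
    s \in S -> t \in S -> s \notin A -> t \notin A ->
    (forall k, k \in S -> k \notin A -> k = s \/ k = t) ->
  {homo coset_twist s t : v r / Cay S v r}.
Proof.
move=> sS tS sNA tNA st_only v r; rewrite /Cay !mem_lcoset => kS.
rewrite -(mulKVg v r); set k := v^-1 * r in kS *.
rewrite /coset_twist dihedral_mem_mul invMg.
have cancel_v (p q : gT) : p^-1 * v^-1 * (v * k * q) = p^-1 * k * q.
  by rewrite !mulgA mulgKV.
have [kA | kNA] := boolP (k \in A).
  have -> : ((v \in A) == true) = (v \in A) by case: (v \in A).
  rewrite cancel_v -mulgA -/(conjg k _).
  exact: dihedral_connection_conj.
have -> : ((v \in A) == false) = (v \notin A) by case: (v \in A).
rewrite cancel_v; case: (v \in A) => /=.
  case: (st_only k kS kNA) => ->; first by rewrite mulVg mul1g.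
  by rewrite -mulgA dihedral_invol // mulg1 hS.
case: (st_only k kS kNA) => ->; last by rewrite mulVg mul1g.
by rewrite -mulgA dihedral_invol // mulg1 hS.
Qed.

Lemma coset_twist_dominates (s t v : gT) :
  s \in S -> t \in S -> dominates (Cay S) v (coset_twist s t v).
Proof.
move=> sS tS; rewrite /dominates /Cay mem_lcoset /coset_twist mulKg.
by case: ifP; rewrite ?sS ?tS orbT.
Qed.

End GeneralisedDihedral.

Lemma card_le2_partner (T : finType) (B : {set T}) (s : T) :
  #|B| <= 2 -> s \in B ->
  exists2 t, t \in B & forall k, k \in B -> k = s \/ k = t.
Proof.
move=> B2 sB; have [B0 | [t tB]] := set_0Vmem (B :\ s).
  exists s => // k kB; left; apply: contraTeq kB => ks.
  by have := in_set0 k; rewrite -B0 !inE ks /= => ->.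
exists t; first by case/setD1P: tB.
have sub : [set s; t] \subset B.
  by rewrite subUset !sub1set sB; case/setD1P: tB.
have ts : t != s by case/setD1P: tB.
have /eqP <- : [set s; t] == B by rewrite eqEcard sub cards2 eq_sym ts.
by move=> k /set2P.
Qed.

Theorem theorem3p6 (gT : finGroupType) (A : {group gT}) (x : gT) (n : nat)
    (S : {set gT})
    (hG : generalised_dihedral [set: gT]%G A x)
    (hn : #|[set: gT]| = (2 * n)%N)
    (hS : inverse_closed S)
    (hSx : #|S :&: x *: A| <= 2) :
  eternal_domination_number (Cay S) = domination_number (Cay S).
Proof.
apply: eternal_domination_number_eq => u w; rewrite /Cay.
case/lcosetP=> s sS ->; have [sA | sNA] := boolP (s \in A).
  (* [s ^ u^-1] is [u * s * u^-1], the left multiplier taking [u] to [u * s]. It moves any [v] along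
     the label [s ^ (u^-1 * v)], a conjugate of [s] and so again in [S]. *)
  exists (mulg (s ^ u^-1)); split; first exact: mulgI.
  - by move=> v r; rewrite !mem_lcoset invMg mulgA mulgKV.
  - move=> v; rewrite /dominates mem_lcoset -/(conjg _ v) -conjgM.
    by rewrite (dihedral_connection_conj hG) ?orbT.
  - by rewrite conjgE invgK !mulgA mulgKV.
have sB : s \in S :&: x *: A by rewrite (dihedral_cosetC hG) !inE sS.
have [t] := card_le2_partner hSx sB; rewrite (dihedral_cosetC hG) !inE.
case/andP=> tNA tS st_only.
have stP k : k \in S -> k \notin A -> k = s \/ k = t.
  by move=> kS kNA; apply: st_only; rewrite !inE kS kNA.
have [uA | uNA] := boolP (u \in A).
  exists (coset_twist A s t); split.
  - exact: (coset_twist_inj hG).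
  - exact: (coset_twist_homo hG).
  - by move=> v; apply: coset_twist_dominates.
  - by rewrite /coset_twist uA.
(* With [u] outside [A] the roles of [s] and [t] are exchanged, so that [u] is still multiplied by
   [s]. *)
exists (coset_twist A t s); split.
- exact: (coset_twist_inj hG).
- apply: (coset_twist_homo hG) => // k kS kNA.
  by case: (stP k kS kNA); [right | left].
- by move=> v; apply: coset_twist_dominates.
- by rewrite /coset_twist (negPf uNA).
Qed.
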